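(* For all integers $n \geq 1$: (i) $\sigma_{e}\mathrm{Mex}(n) \equiv \bar{p}_{\geq 2}(n) \pmod{2}$; (ii) $\sigma_{e}\mathrm{Mex}(n) \equiv \bar{p}_{\geq 2}(n) \pmod{2^2}$ if and only if $n$ is a perfect square.
   Context: An overpartition of a non-negative integer $n$ is a partition of $n$ (a finite non-increasing sequence of positive integers with sum $n$) in which the first occurrence of each distinct part may or may not be overlined; the empty overpartition is the only overpartition of $0$. Let $\bar{P}(n)$ be the set of all overpartitions of $n$. For $\lambda\in\bar P(n)$, $\mathrm{Mex}(\lambda)$ is the smallest positive integer that does not occur as a part of $\lambda$, whether overlined or non-overlined. Let $\mathrm{Mex}_e(\lambda)=\mathrm{Mex}(\lambda)$ if $\mathrm{Mex}(\lambda)$ is even, and $\mathrm{Mex}_e(\lambda)=0$ otherwise. Define $\sigma_e\mathrm{Mex}(n)=\sum_{\lambda\in\bar P(n)}\mathrm{Mex}_e(\lambda)$. Let $\bar p_{\geq 2}(n)$ be the number of overpartitions of $n$ all of whose parts are at least $2$. *)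

(* Defs.v *)
From HB Require Import structures.
From mathcomp Require Import all_boot.

Set Implicit Arguments.
Unset Strict Implicit.
Unset Printing Implicit Defensive.

(* An overlined partition is written as the list of its parts, each part tagged
   with a boolean that is true when this occurrence of the part is overlined. *)
Definition parts (s : seq (nat * bool)) : seq nat := map fst s.

Definition is_overpartition (n : nat) (s : seq (nat * bool)) : bool :=
  [&& sorted geq (parts s), all (leq 1) (parts s), sumn (parts s) == n
    & [forall i : 'I_(size s), (nth (0, false) s i).2 ==>
         (nth 0 (parts s) i \notin take i (parts s))]].

Record overpartition (n : nat) := Overpartition {
  opval :> seq (nat * bool);
  _ : is_overpartition n opval }.

HB.instance Definition _ n := [isSub for @opval n].
HB.instance Definition _ n := [Countable of overpartition n by <:].

Lemma mem_leq_sumn (s : seq nat) m : m \in s -> m <= sumn s.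
Proof.
elim: s => //= x s IH; rewrite inE => /orP[/eqP->|/IH]; first exact: leq_addr.
by move/leq_trans; apply; exact: leq_addl.
Qed.

Lemma size_leq_sumn (s : seq nat) : all (leq 1) s -> size s <= sumn s.
Proof.
by elim: s => //= x s IH /andP[x0 /IH h]; rewrite -add1n leq_add.
Qed.

(* An overpartition of n has at most n parts, each at most n, so it embeds in a
   finite type of bounded sequences. *)
Definition op_enc n (l : overpartition n) : n.-bseq ('I_n.+1 * bool) :=
  insub_bseq n [seq (inord p.1, p.2) | p <- opval l].

Definition op_dec n (t : n.-bseq ('I_n.+1 * bool)) : option (overpartition n) :=
  insub [seq (val p.1, p.2) | p <- t].

Lemma op_encK n : pcancel (@op_enc n) (@op_dec n).
Proof.
case=> s sP; have /and4P[_ pos /eqP sum _] := sP; rewrite /op_dec /op_enc.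
have hs : size [seq (inord p.1 : 'I_n.+1, p.2) | p <- s] <= n.
  by rewrite size_map -(size_map fst) -[leqRHS]sum size_leq_sumn.
rewrite /insub_bseq insubdK //= -map_comp.
have -> : map ((fun p : 'I_n.+1 * bool => (val p.1, p.2)) \o
                 (fun p => (inord p.1, p.2))) s = s.
  rewrite -[RHS]map_id; apply/eq_in_map => -[a b] abs /=.
  rewrite inordK // ltnS -sum mem_leq_sumn //.
  by apply/mapP; exists (a, b).
by rewrite insubT /=; congr Some; apply: val_inj.
Qed.

HB.instance Definition _ n : isFinite (overpartition n) := PCanIsFinite (@op_encK n).

Lemma mex_exists (s : seq nat) : exists m, (0 < m) && (m \notin s).
Proof.
exists (sumn s).+1; apply/negP => /mem_leq_sumn; by rewrite ltnn.
Qed.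

Definition Mex (s : seq (nat * bool)) : nat := ex_minn (mex_exists (parts s)).

Definition Mex_e (s : seq (nat * bool)) : nat :=
  if ~~ odd (Mex s) then Mex s else 0.

Definition sigma_e_Mex (n : nat) : nat := \sum_(l : overpartition n) Mex_e l.

Definition pbar_ge2 (n : nat) : nat :=
  #|[set l : overpartition n | all (leq 2) (parts l)]|.

(* Main.v *)
Require Import Defs.
From mathcomp Require Import all_boot.
From mathcomp Require Import zify.

Set Implicit Arguments.
Unset Strict Implicit.
Unset Printing Implicit Defensive.

(** Flipping the overline on the first occurrence of the largest part is a
    fixed-point-free involution of the overpartitions of [n], so both quantities
    are twice the sum over those whose largest part is not overlined.  As [Mex_e]
    is even, [sigma_e_Mex n] is divisible by 4.  Flipping the smallest part as well
    pairs off the remaining overpartitions with at least two distinct part sizes;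
    those with a single part size [d >= 2] correspond to the divisors [d] of [n].
    Thus [pbar_ge2 n] is [2 * (d(n) - 1)] modulo 4, where the number of divisors
    [d(n)] is odd exactly when [n] is a square. *)

(** The involution exchanges the elements of [P] where [b] holds with those where it fails, so both
    halves contribute the same sum. *)
Lemma sum_involution_double (T : finType) (f : T -> T) (P b : pred T) (F : T -> nat) :
    involutive f -> (forall x, P (f x) = P x) ->
    (forall x, P x -> b (f x) = ~~ b x) -> (forall x, P x -> F (f x) = F x) ->
  \sum_(x | P x) F x = 2 * \sum_(x | P x && ~~ b x) F x.
Proof.
move=> fK Pf bf Ff; rewrite (bigID b) mul2n -addnn /=; congr (_ + _).
rewrite (reindex_inj (inv_inj fK)) /=; apply: eq_big => [x|x /andP[Px _]].
  by rewrite Pf; case Px: (P x); rewrite //= bf.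
by rewrite Ff // -Pf.
Qed.

(** * Switching the overline of one part size *)

Section Flip.

Implicit Type s : seq (nat * bool).

(** Only the first occurrence of a part can carry an overline, so its tag, found through [index],
    decides for the part size. *)
Definition overlined x s := nth false (map snd s) (index x (parts s)).

Fixpoint flip x s :=
  if s is p :: s' then
    if p.1 == x then (p.1, ~~ p.2) :: s' else p :: flip x s'
  else [::].

Lemma parts_flip x s : parts (flip x s) = parts s.
Proof. by elim: s => //= p s IH; case: ifP => //= _; rewrite IH. Qed.

Lemma flipK x : involutive (flip x).
Proof.
by elim=> //= -[a c] s IH; case: ifP => /= h; rewrite h ?negbK ?IH.
Qed.

Lemma overlined_flip x s : x \in parts s -> overlined x (flip x s) = ~~ overlined x s.
Proof.
rewrite /overlined parts_flip; elim: s => //= p s IH.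
by rewrite inE eq_sym; case: ifP => //= _ /IH.
Qed.

Lemma overlined_flip_neq x y s : x != y -> overlined x (flip y s) = overlined x s.
Proof.
rewrite /overlined parts_flip => xy; elim: s => //= p s IH.
case: (p.1 =P y) => [py|_] /=; last by case: ifP.
by rewrite py eq_sym (negPf xy).
Qed.

Lemma nth_flip x s i : x \in parts s ->
  (nth (0, false) (flip x s) i).2
  = (nth (0, false) s i).2 (+) (i == index x (parts s)).
Proof.
elim: s i => //= p s IH i; rewrite inE eq_sym; case: ifP => /= [_ _|_ /IH {}IH].
  by case: i => [|i] /=; rewrite ?addbT ?addbF.
by case: i => [|i] /=; rewrite ?addbF.
Qed.

Lemma flip_notin x s : x \notin parts s -> flip x s = s.
Proof.
by elim: s => //= p s IH; rewrite inE eq_sym negb_or => /andP[/negPf-> /IH->].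
Qed.

(** Only the tag at the first occurrence of [x] changes, and there either tag is allowed. *)
Lemma flip_overpartition n x s :
  is_overpartition n s -> is_overpartition n (flip x s).
Proof.
case: (boolP (x \in parts s)) => [xs|/flip_notin -> //].
rewrite /is_overpartition parts_flip => /and4P[-> -> -> /forallP h] /=.
have szf : size (flip x s) = size s.
  by rewrite -(size_map fst) -/(parts _) parts_flip size_map.
apply/forallP=> i; apply/implyP; rewrite nth_flip //.
case: (nat_of_ord i =P index x (parts s)) => [->|_].
  by rewrite nth_index // in_take // ltnn.
have li : i < size s by rewrite -szf.
by rewrite addbF; apply/implyP: (h (Ordinal li)).
Qed.

End Flip.

(** * Pairing off overpartitions by flips of extreme parts *)

Section Overpartitions.

Variable n : nat.
Implicit Type l : overpartition n.

Definition flip_op x l : overpartition n :=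
  Overpartition (flip_overpartition x (valP l)).

(** The part to flip is chosen from the underlying parts alone; a flip preserves these, so a second
    application chooses the same part and undoes the first. *)
Definition flip_sel (sel : seq nat -> nat) l := flip_op (sel (parts l)) l.

Lemma parts_flip_sel sel l : parts (flip_sel sel l) = parts l.
Proof. exact: parts_flip. Qed.

Lemma flip_selK sel : involutive (flip_sel sel).
Proof.
by move=> l; apply: val_inj; rewrite /= parts_flip flipK.
Qed.

Notation largest l := (head 0 (parts l)).
Notation smallest l := (last 0 (parts l)).

Lemma sumn_parts l : sumn (parts l) = n.
Proof. by have /and4P[_ _ /eqP] := valP l. Qed.

Lemma overpartition_neq0 l : 0 < n -> parts l != [::].
Proof. by move=> n0; apply/eqP => l0; move: n0; rewrite -(sumn_parts l) l0. Qed.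

Lemma largest_in l : 0 < n -> largest l \in parts l.
Proof.
by move=> /(overpartition_neq0 l); case: (parts l) => //= x s _; rewrite mem_head.
Qed.

Lemma smallest_in l : 0 < n -> smallest l \in parts l.
Proof.
by move=> /(overpartition_neq0 l); case: (parts l) => //= x s _; apply: mem_last.
Qed.

Lemma sum_flip_largest (P : pred (seq nat)) (F : seq nat -> nat) : 0 < n ->
  \sum_(l : overpartition n | P (parts l)) F (parts l)
  = 2 * \sum_(l : overpartition n | P (parts l) && ~~ overlined (largest l) l)
          F (parts l).
Proof.
move=> n0; apply: (sum_involution_double (flip_selK (head 0))) => l *;
  rewrite ?parts_flip_sel //.
by rewrite overlined_flip // largest_in.
Qed.

(** Sorted parts are squeezed between the largest and the smallest. The empty list fits too, both
    defaults being 0. *)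
Lemma constant_parts l : (largest l == smallest l) = constant (parts l).
Proof.
have /and4P[+ _ _ _] := valP l; case: (parts l) => //= x s xs.
apply/eqP/idP => [xl|/all_pred1P ->]; last first.
  by elim: (size s).
apply/allP => y ys /=.
have geq_tr : transitive geq by move=> a b c /= ba ac; exact: leq_trans ac ba.
have yx : y <= x by have /allP := order_path_min geq_tr xs; apply.
case/splitPr: ys xs xl => s1 s2; rewrite cat_path last_cat /= => /and3P[_ _ ps2] xl.
rewrite eqn_leq yx xl /=.
have := mem_last y s2; rewrite inE => /orP[/eqP->//|].
by have /allP := order_path_min geq_tr ps2; apply.
Qed.

(** When the parts are not all equal, the smallest differs from the largest, so flipping it leaves
    the overline of the largest alone and pairs these overpartitions off. *)
Lemma card_flip_smallest (P : pred (seq nat)) : 0 < n ->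
  exists c, #|[set l : overpartition n |
                P (parts l) && ~~ overlined (largest l) l]|
  = 2 * c + #|[set l : overpartition n |
                [&& constant (parts l), P (parts l) & ~~ overlined (largest l) l]]|.
Proof.
move=> n0.
pose Q l := [&& ~~ constant (parts l), P (parts l) & ~~ overlined (largest l) l].
exists (\sum_(l | Q l && ~~ overlined (smallest l) l) 1).
rewrite -(@sum_involution_double _ (flip_sel (last 0)) Q).
- rewrite -!sum1dep_card (bigID (fun l => constant (parts l))) addnC /=.
  by congr (_ + _); apply: eq_bigl => l; rewrite andbC.
- exact: flip_selK.
- move=> l; rewrite /Q parts_flip_sel -constant_parts.
  by case: eqP => //= /eqP hl; rewrite overlined_flip_neq.
- by move=> l _; rewrite parts_flip_sel overlined_flip // smallest_in.
- by [].
Qed.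

(** The first part is not overlined by hypothesis, and a later one cannot be, since it repeats the
    first. *)
Lemma constant_overpartition l :
    constant (parts l) -> ~~ overlined (largest l) l ->
  opval l = nseq (size l) (largest l, false).
Proof.
move=> cl ol; apply/all_pred1P/allP => p pl.
have [i lt_i ep] : exists2 i, i < size l & nth (0, false) l i = p.
  by exists (index p l); rewrite ?index_mem ?nth_index.
have /and4P[_ _ _ /forallP/(_ (Ordinal lt_i))] := valP l; rewrite /= ep.
have : p.1 \in parts l by apply: map_f.
have : nth 0 (parts l) i \in parts l by rewrite mem_nth // size_map.
move: cl ol ep; case: (opval l) => [|q s] //; rewrite /overlined /= eqxx /=.
move=> /all_pred1P es oq ep.
have head_eq y : y \in q.1 :: map fst s -> y = q.1.
  by rewrite -/(parts s) es inE mem_nseq => /orP[/eqP|/andP[_ /eqP]].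
move=> /head_eq -> /head_eq e1; case: i lt_i ep => [|i] _ ep /=.
  by case: p ep e1 pl => a c /= <- /= _ _ _; move: oq; case: (q) => ? [].
rewrite inE eqxx /= implybF => /negPf p2.
by case: p p2 e1 {pl ep} => a c /= -> ->.
Qed.

Lemma nseq_overpartition d : 0 < d -> d %| n ->
  is_overpartition n (nseq (n %/ d) (d, false)).
Proof.
move=> d0 dn; rewrite /is_overpartition /parts map_nseq /= sumn_nseq mulnC divnK // eqxx.
apply/and4P; split => //.
- by case: (n %/ d) => //= k; elim: k => //= k ->; rewrite leqnn.
- by rewrite all_nseq d0 orbT.
- by apply/forallP => i; rewrite nth_nseq; case: ifP.
Qed.

(** The bijection sends [l] to its repeated part [d], with inverse [n %/ d] plain copies of [d]. *)
Lemma card_constant_ge2 : 0 < n ->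
  #|[set l : overpartition n |
      [&& constant (parts l), all (leq 2) (parts l) & ~~ overlined (largest l) l]]|
  = #|[set d : 'I_n.+1 | (1 < d) && (d %| n)]|.
Proof.
move=> n0; set A := finset _; set D := finset _.
have sumE l : l \in A -> n = largest l * size l.
  rewrite inE => /and3P[cl _ ol].
  apply: etrans (esym (sumn_parts l)) _; have := constant_overpartition cl ol.
  by move: (largest l) (size l) => d k lE; rewrite /parts lE map_nseq sumn_nseq.
have dvd l : l \in A -> largest l %| n.
  by move=> lA; apply/dvdnP; exists (size l); rewrite mulnC; exact: sumE.
have lt l : l \in A -> largest l < n.+1.
  by move=> /dvd dn; rewrite ltnS dvdn_leq.
pose g l : 'I_n.+1 := inord (largest l).
have gE l : l \in A -> g l = largest l :> nat by move=> /lt; exact: inordK.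
rewrite -(card_in_imset (f := g) (D := A)); last first.
  move=> l1 l2 A1 A2 /(congr1 val) /=; rewrite gE // gE // => e.
  (* The number of copies is forced by [n = largest * size]. *)
  have eqs : size l1 = size l2.
    have := etrans (esym (sumE _ A1)) (sumE _ A2); rewrite e => /eqP.
    rewrite eqn_pmul2l => [/eqP //|]; exact: dvdn_gt0 n0 (dvd _ A2).
  apply: val_inj; move: A1 A2; rewrite !inE => /and3P[c1 _ o1] /and3P[c2 _ o2].
  by rewrite /= (constant_overpartition c1 o1) (constant_overpartition c2 o2) e eqs.
congr #|pred_of_set _|; apply/setP => d; rewrite [in RHS]inE.
apply/imsetP/andP => [[l lA ->]|[d1 dn]].
  rewrite gE // dvd //; split=> //.
  by move: lA; rewrite inE => /and3P[_ /allP h _]; apply: h; exact: largest_in.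
have d0 := ltnW d1.
pose l := Overpartition (nseq_overpartition d0 dn).
have q0 : 0 < n %/ d by rewrite divn_gt0 // dvdn_leq.
have ll : largest l = d.
  by rewrite /l /=; case: (n %/ d) q0.
have lA : l \in A.
  rewrite inE ll /l /= /overlined /parts !map_nseq all_nseq d1 orbT /=.
  rewrite nth_nseq if_same andbT.
  by case: (n %/ d) => //= k; rewrite all_nseq /= eqxx orbT.
by exists l => //; apply: val_inj; rewrite [RHS]gE // ll.
Qed.

End Overpartitions.

(** * Parity of the number of divisors *)

(** The map [d] to [n %/ d], extended by the identity to non-divisors, pairs off the divisors except
    a square root of [n]. *)
Lemma card_divisors_parity n : 0 < n ->
  exists c, #|[set d : 'I_n.+1 | d %| n]| = 2 * c + #|[set d : 'I_n.+1 | d ^ 2 == n]|.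
Proof.
move=> n0; pose f (d : 'I_n.+1) : 'I_n.+1 := if d %| n then inord (n %/ d) else d.
have fE (d : 'I_n.+1) : d %| n -> f d = n %/ d :> nat.
  by rewrite /f => -> ; rewrite inordK // ltnS leq_div.
have fdvd (d : 'I_n.+1) : (f d %| n) = (d %| n).
  case dn: (d %| n); first by rewrite fE //; apply/dvdnP; exists d; rewrite mulnC divnK.
  by rewrite /f dn.
have fK : involutive f.
  move=> d; case dn: (d %| n); last by rewrite /f !dn.
  by apply: val_inj; rewrite /= fE ?fdvd // fE // divnA // mulKn.
have mulf (d : 'I_n.+1) : d %| n -> f d * d = n by move=> dn; rewrite fE // divnK.
pose P (d : 'I_n.+1) := (d %| n) && (d ^ 2 != n).
(* Since [f d * d = n], exactly one member of each pair has square below [n]. *)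
exists (\sum_(d | P d && ~~ (d ^ 2 < n)) 1).
rewrite -(@sum_involution_double _ f P) //.
- rewrite -!sum1dep_card (bigID (fun d : 'I_n.+1 => d ^ 2 == n)) addnC /=.
  congr (_ + _); apply: eq_bigl => d.
  by case: eqP => [dn|_]; rewrite ?andbF // andbT -[X in _ %| X]dn dvdn_mulr.
- move=> d; rewrite /P fdvd; case dn: (d %| n) => //=.
  by have := mulf d dn; move: (nat_of_ord (f d)) (nat_of_ord d) => a b ab; nia.
- move=> d /andP[/mulf]; move: (nat_of_ord (f d)) (nat_of_ord d) => a b ab; nia.
Qed.

Lemma card_sqrt n : 0 < n ->
  #|[set d : 'I_n.+1 | d ^ 2 == n]| <= 1 /\
  ((exists k, n = k ^ 2) <-> #|[set d : 'I_n.+1 | d ^ 2 == n]| = 1).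
Proof.
move=> n0; set S := finset _.
have S1 : #|S| <= 1.
  apply/card_le1P => x; rewrite inE => /eqP xn y; rewrite !inE.
  by rewrite -(inj_eq val_inj) /= -[RHS]eqn_sqr xn.
split=> //; split=> [[k nk]|/eqP /cards1P [d Sd]]; last first.
  by exists d; have := set11 d; rewrite -Sd inE => /eqP.
apply/eqP; rewrite eqn_leq S1 card_gt0; apply/set0Pn.
have kn : k < n.+1 by nia.
by exists (Ordinal kn); rewrite inE /= nk.
Qed.

(** * Both quantities modulo 4 *)

Lemma dvd4_sigma_e_Mex n : 0 < n -> 4 %| sigma_e_Mex n.
Proof.
move=> n0.
pose M (s : seq nat) := ex_minn (mex_exists s).
rewrite /sigma_e_Mex.
(* [Mex] sees only the parts, so the flip preserves it. The pairing gives one factor 2, the evenness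
   of each term the other. *)
rewrite (sum_flip_largest predT (fun s => if ~~ odd (M s) then M s else 0) n0).
rewrite (@dvdn_pmul2l 2 2) //; apply: dvdn_sum => l _.
by case: ifP; rewrite ?dvdn0 // dvdn2.
Qed.

(** Adding 2 restores the divisor 1, which is not an admissible part, and avoids truncated
    subtraction. *)
Lemma pbar_ge2_mod4 n : 0 < n ->
  exists c, pbar_ge2 n + 2 = 2 * (2 * c + #|[set d : 'I_n.+1 | d %| n]|).
Proof.
move=> n0; have [c hc] := @card_flip_smallest n (all (leq 2)) n0.
exists c; rewrite (cardsD1 (Ordinal (n0 : 1 < n.+1))) inE dvd1n.
have -> : [set d : 'I_n.+1 | d %| n] :\ Ordinal (n0 : 1 < n.+1)
          = [set d : 'I_n.+1 | (1 < d) && (d %| n)].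
  apply/setP => d; rewrite !inE -(inj_eq val_inj) /=.
  by case: (nat_of_ord d) => [|[|k]] //=; rewrite dvd0n gtn_eqF.
rewrite -card_constant_ge2 // addnCA -hc /pbar_ge2 -!sum1dep_card.
by rewrite (sum_flip_largest (all (leq 2)) (fun=> 1) n0) mulnDr addnC.
Qed.

Theorem corollary1p7 (n : nat) (hn : 1 <= n) :
  (sigma_e_Mex n = pbar_ge2 n %[mod 2]) /\
  ((sigma_e_Mex n = pbar_ge2 n %[mod 2 ^ 2]) <-> (exists k : nat, n = k ^ 2)).
Proof.
have /dvdnP[a ->] := dvd4_sigma_e_Mex hn.
have [c pE] := pbar_ge2_mod4 hn.
have [e dE] := card_divisors_parity hn.
have [le1 ->] := card_sqrt hn.
rewrite dE in pE; move: le1 pE.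
(* Now [p + 2 = 4 * (c + e) + 2 * t] with [t <= 1], so [p] is even, and divisible by 4 exactly when
   [t = 1]. *)
move: (pbar_ge2 n) #|_| => p t le1 pE; split; first by lia.
by split; lia.
Qed.
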